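(* Let $n\ge 2$ be an integer. The Killing form $\mathfrak B$ of the Lie algebra $\mathfrak l=\mathcal A\oplus\mathcal H$ is non-degenerate, and $\mathfrak l$ is semisimple.
   Context: Fix an orthonormal basis $v_1,\ldots,v_{n-1}$ of the hyperplane $\{x\in\mathbb R^n: x_1+\cdots+x_n=0\}$. For $a,b\in\mathbb R^n$, $a\otimes b$ denotes the $n\times n$ matrix $(a_ib_j)_{i,j}$. Set $$\mathcal A=\mathrm{span}\{v_i\otimes v_j: 1\le i,j\le n-1,\ i\neq j\},\qquad \mathcal H=\Big\{\sum_{\ell=1}^{n-1}\gamma_\ell\,(v_\ell\otimes v_\ell): \gamma_\ell\in\mathbb R,\ \sum_{\ell=1}^{n-1}\gamma_\ell=0\Big\},\qquad \mathfrak l=\mathcal A\oplus\mathcal H,$$ where $\mathfrak l$ is a real Lie algebra under the matrix commutator $[A,B]=AB-BA$ (it consists of the real traceless $n\times n$ matrices with all row and column sums zero). The Killing form is $\mathfrak B(X,Y)=\mathrm{Tr}(\mathrm{ad}X\,\mathrm{ad}Y)$, the trace being that of an endomorphism of $\mathfrak l$. The zero Lie algebra (case $n=2$) is counted as semisimple. *)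

(* Defs.v *)
From HB Require Import structures.
From mathcomp Require Import all_boot all_order all_algebra reals ring.

Set Implicit Arguments.
Unset Strict Implicit.
Unset Printing Implicit Defensive.

Import GRing.Theory passmx.

Local Open Scope ring_scope.

HB.mixin Record Vector_isLieAlgebra (K : fieldType) L of Vector K L := {
  lie : L -> L -> L;
  lie_linearl : forall y, linear (lie ^~ y);
  lie_linearr : forall x, linear (lie x);
  liexx : forall x, lie x x = 0;
  lie_jacobi : forall x y z,
    lie x (lie y z) + lie y (lie z x) + lie z (lie x y) = 0
}.

#[short(type="lieAlgType")]
HB.structure Definition LieAlgebra (K : fieldType) :=
  { L of Vector_isLieAlgebra K L & Vector K L }.

Definition lftrace (K : fieldType) (V : vectType K) (f : 'End(V)) : K :=
  \tr (mxof (vbasis fullv) (vbasis fullv) f).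

Section LieTheory.
Variables (K : fieldType) (L : lieAlgType K).
Implicit Types (x y z : L) (U W I : {vspace L}).

HB.instance Definition _ x := GRing.isSemilinear.Build K L L _ (lie x)
  (GRing.semilinear_linear (lie_linearr x)).

Definition ad x : 'End(L) := linfun (lie x).

Definition killing x y : K := lftrace (ad x \o ad y)%VF.

Fact lie_linearlE a x y z : lie (a *: x + y) z = a *: lie x z + lie y z.
Proof. exact: lie_linearl. Qed.

Fact lie0l y : lie 0 y = 0.
Proof.
by have := lie_linearlE (-1) 0 0 y; rewrite scaler0 addr0 scaleN1r addNr.
Qed.

Lemma lftrace_linear : scalar (@lftrace K L).
Proof. by move=> a f g; rewrite /lftrace linearP /= linearP. Qed.

Lemma ad_linear : linear ad.
Proof.
by move=> a x y; apply/lfunP=> z; rewrite add_lfunE scale_lfunE !lfunE /= lie_linearlE.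
Qed.

Lemma killingC x y : killing x y = killing y x.
Proof.
by rewrite /killing /lftrace !(mxof_comp _ _ (vbasisP fullv)) mxtrace_mulC.
Qed.

Lemma killing_linearr x : scalar (killing x).
Proof.
by move=> a y z; rewrite /killing ad_linear comp_lfunDr -comp_lfunZr lftrace_linear.
Qed.

Lemma killing_bilinear : bilinear_for *%R (idfun \; *%R) killing.
Proof.
split=> [y a x z|x]; last exact: killing_linearr.
by rewrite /= ![killing _ y]killingC killing_linearr.
Qed.

HB.instance Definition _ :=
  bilinear_isBilinear.Build K L L K *%R (idfun \; *%R) killing killing_bilinear.

Lemma killing_hermitian x y :
  killing x y = (-1) ^+ false * idfun (killing y x).
Proof. by rewrite expr0 mul1r killingC. Qed.

HB.instance Definition _ :=
  isHermitianSesquilinear.Build K L false idfun killing killing_hermitian.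

(* The span [U, W] of all the brackets of elements of U and W; see liebrvP. *)
Definition liebrv U W : {vspace L} :=
  <<[seq lie x y | x <- vbasis U, y <- vbasis W]>>%VS.

Lemma liebrvP U W I :
  reflect (forall x y, x \in U -> y \in W -> lie x y \in I)
          (liebrv U W <= I)%VS.
Proof.
apply: (iffP idP) => [sX x y Ux Wy | sX]; last first.
  by apply/span_subvP=> _ /allpairsP[[x y] /= [Ux Wy ->]]; rewrite sX ?vbasis_mem.
apply: (subvP sX); rewrite (coord_vbasis Wy) linear_sum memv_suml // => j _.
rewrite linearZ memvZ //= (coord_vbasis Ux).
elim/big_rec: _ => [|i z _ zP].
  by rewrite lie0l mem0v.
by rewrite lie_linearlE memvD // memvZ // memv_span // allpairs_f // mem_nth ?size_tuple.
Qed.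

Definition lie_ideal I := forall x y, y \in I -> lie x y \in I.

Definition lie_solvable I := exists k, iter k (fun U => liebrv U U) I = 0%VS.

End LieTheory.

(* The radical, i.e. the sum of all solvable ideals, is zero. The zero
   algebra satisfies this. *)
Definition semisimple (K : fieldType) (L : lieAlgType K) :=
  forall I : {vspace L}, lie_ideal I -> lie_solvable I -> I = 0%VS.

Section MatrixLie.
Variables (K : fieldType) (n : nat).

Definition mxcomm (A B : 'M[K]_n) : 'M[K]_n := A *m B - B *m A.

Definition mxcomm_closed (L : {vspace 'M[K]_n}) :=
  {in L &, forall A B, mxcomm A B \in L}.

Definition mxlie (L : {vspace 'M[K]_n}) of mxcomm_closed L : Type := subvs_of L.

Variables (L : {vspace 'M[K]_n}) (clL : mxcomm_closed L).

HB.instance Definition _ := Vector.copy (mxlie clL) (subvs_of L).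

Definition mxlie_bracket (x y : mxlie clL) : mxlie clL :=
  Subvs (clL (subvsP x) (subvsP y)).

Fact mxlie_linearl y : linear (mxlie_bracket ^~ y).
Proof.
move=> a x z; apply: val_inj; rewrite /= /mxcomm mulmxDl mulmxDr.
by rewrite -scalemxAl -scalemxAr scalerBr opprD addrACA.
Qed.

Fact mxlie_linearr x : linear (mxlie_bracket x).
Proof.
move=> a y z; apply: val_inj; rewrite /= /mxcomm mulmxDl mulmxDr.
by rewrite -scalemxAl -scalemxAr scalerBr opprD addrACA.
Qed.

Fact mxliexx x : mxlie_bracket x x = 0.
Proof. by apply: val_inj; rewrite /= /mxcomm subrr. Qed.

Fact mxlie_jacobi x y z :
  mxlie_bracket x (mxlie_bracket y z) + mxlie_bracket y (mxlie_bracket z x)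
    + mxlie_bracket z (mxlie_bracket x y) = 0.
Proof.
apply: val_inj; rewrite /= /mxcomm !mulmxBr !mulmxBl !mulmxA.
move: (val x) (val y) (val z) => a b c.
set p1 := a *m b *m c; set p2 := a *m c *m b; set p3 := b *m c *m a.
set p4 := b *m a *m c; set p5 := c *m a *m b; set p6 := c *m b *m a.
by apply/matrixP=> i j; rewrite !mxE; ring.
Qed.

HB.instance Definition _ := Vector_isLieAlgebra.Build K (mxlie clL)
  mxlie_linearl mxlie_linearr mxliexx mxlie_jacobi.

End MatrixLie.

Section Spaces.
Variables (R : realType) (n : nat).

Definition coord_sum (m : nat) (x : 'rV[R]_m) : R^o := \sum_i x 0 i.

Fact coord_sum_linear m : linear (@coord_sum m).
Proof.
move=> a x y; rewrite /coord_sum scaler_sumr -big_split.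
by apply: eq_bigr => i _; rewrite !mxE.
Qed.

HB.instance Definition _ m := GRing.isSemilinear.Build R 'rV[R]_m R^o _
  (@coord_sum m) (GRing.semilinear_linear (@coord_sum_linear m)).

Definition sum0_space (m : nat) : {vspace 'rV[R]_m} :=
  lker (linfun (@coord_sum m)).

Lemma sum0_spaceP m (x : 'rV[R]_m) :
  reflect (\sum_i x 0 i = 0) (x \in sum0_space m).
Proof. by rewrite memv_ker lfunE; apply: eqP. Qed.

Definition dotv (a b : 'rV[R]_n) : R := \sum_k a 0 k * b 0 k.

Definition orthonormal_basis m (U : {vspace 'rV[R]_n})
    (v : m.-tuple 'rV[R]_n) :=
  basis_of U v /\ forall i j, dotv (tnth v i) (tnth v j) = (i == j)%:R.

Definition tens (a b : 'rV[R]_n) : 'M[R]_n := \matrix_(i, j) (a 0 i * b 0 j).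

Variables (m : nat) (v : m.-tuple 'rV[R]_n).

Definition Aspace : {vspace 'M[R]_n} :=
  <<[seq tens (tnth v ij.1) (tnth v ij.2) |
       ij : 'I_m * 'I_m in [pred ij | ij.1 != ij.2]]>>%VS.

Definition diag_tens (g : 'rV[R]_m) : 'M[R]_n :=
  \sum_l g 0 l *: tens (tnth v l) (tnth v l).

Fact diag_tens_linear : linear diag_tens.
Proof.
move=> a x y; rewrite /diag_tens scaler_sumr -big_split.
by apply: eq_bigr => i _; rewrite !mxE scalerDl scalerA.
Qed.

HB.instance Definition _ := GRing.isSemilinear.Build R 'rV[R]_m 'M[R]_n _
  diag_tens (GRing.semilinear_linear diag_tens_linear).

Definition Hspace : {vspace 'M[R]_n} := (linfun diag_tens @: sum0_space m)%VS.

Lemma HspaceP X :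
  reflect (exists2 g : 'rV[R]_m, \sum_l g 0 l = 0 &
             X = \sum_l g 0 l *: tens (tnth v l) (tnth v l))
          (X \in Hspace).
Proof.
apply: (iffP memv_imgP) => [[g /sum0_spaceP g0 ->]|[g g0 ->]].
  by exists g; rewrite ?lfunE.
by exists g; [exact/sum0_spaceP | rewrite lfunE].
Qed.

Definition lspace : {vspace 'M[R]_n} := (Aspace + Hspace)%VS.

(* The traceless matrices with zero row and column sums; see lspaceE. *)
Definition zero_sums_space : {vspace 'M[R]_n} :=
  (lker (linfun (mxtrace : 'M[R]_n -> R^o)) :&:
   lker (linfun (mulmxr (const_mx 1 : 'cV[R]_n) : 'M[R]_n -> 'cV[R]_n)) :&:
   lker (linfun (mulmx (const_mx 1 : 'rV[R]_n) : 'M[R]_n -> 'rV[R]_n)))%VS.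

Lemma zero_sums_spaceP X :
  reflect [/\ \tr X = 0, X *m (const_mx 1 : 'cV_n) = 0
            & (const_mx 1 : 'rV_n) *m X = 0]
          (X \in zero_sums_space).
Proof.
rewrite !memv_cap !memv_ker !lfunE /=.
by apply: (iffP andP) => [[/andP[/eqP ? /eqP ?] /eqP ?]|[-> -> ->]]; rewrite ?eqxx.
Qed.

Lemma zero_sums_closed : mxcomm_closed zero_sums_space.
Proof.
move=> A B /zero_sums_spaceP[_ Ar Ac] /zero_sums_spaceP[_ Br Bc].
apply/zero_sums_spaceP; rewrite /mxcomm; split.
- by rewrite linearB /= mxtrace_mulC subrr.
- by rewrite mulmxBl -!mulmxA Ar Br !mulmx0 subrr.
- by rewrite mulmxBr !mulmxA Ac Bc !mul0mx subrr.
Qed.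

Definition tens_coef i j (X : 'M[R]_n) : R^o :=
  (tnth v i *m X *m (tnth v j)^T) 0 0.

Fact tens_coef_linear i j : linear (tens_coef i j).
Proof.
move=> a X Y; rewrite /tens_coef mulmxDr mulmxDl -scalemxAr -scalemxAl.
by rewrite [LHS]mxE [X in X + _]mxE.
Qed.

HB.instance Definition _ i j := GRing.isSemilinear.Build R 'M[R]_n R^o _
  (tens_coef i j) (GRing.semilinear_linear (tens_coef_linear i j)).

Hypothesis v_basis : orthonormal_basis (sum0_space n) v.

Let t := tnth v.
Let coef := tens_coef.

Let tensE a b : tens a b = a^T *m b.
Proof. by apply/matrixP=> i j; rewrite !mxE big_ord1 !mxE. Qed.

Let tt i j : t i *m (t j)^T = (i == j)%:R%:M.
Proof.
apply/matrixP=> p q; rewrite !ord1 !mxE eqxx mulr1n -(proj2 v_basis).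
by apply: eq_bigr => k _; rewrite mxE.
Qed.

Let t1 i : t i *m (const_mx 1 : 'cV_n) = 0.
Proof.
have /sum0_spaceP ti : t i \in sum0_space n.
  by apply: (basis_mem (proj1 v_basis)); apply: mem_tnth.
apply/matrixP=> p q; rewrite !ord1 !mxE -[RHS]ti.
by apply: eq_bigr => k _; rewrite mxE mulr1.
Qed.

Let coefE i j k l : coef i j (tens (t k) (t l)) = ((i == k) && (l == j))%:R.
Proof.
rewrite /coef /tens_coef tensE mulmxA tt -mulmxA tt -scalar_mxM mxE eqxx mulr1n.
by rewrite -natrM mulnb.
Qed.

Let trE k l : \tr (tens (t k) (t l)) = (k == l)%:R.
Proof. by rewrite tensE mxtrace_mulC tt mxtrace_scalar mulr1n eq_sym. Qed.

Let tens_zero i j : i != j -> tens (t i) (t j) \in zero_sums_space.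
Proof.
move=> ij; apply/zero_sums_spaceP; rewrite trE (negPf ij) tensE; split=> //.
  by rewrite -mulmxA t1 mulmx0.
rewrite mulmxA -[X in X *m _]trmxK trmx_mul trmxK.
by rewrite trmx_const t1 trmx0 mul0mx.
Qed.

Let resolution X : X \in zero_sums_space ->
  X = \sum_i \sum_j coef i j X *: tens (t i) (t j).
Proof.
move/zero_sums_spaceP=> [_ Xr Xc].
pose P := \sum_i tens (t i) (t i).
have uP (u : 'rV_n) : u *m (const_mx 1 : 'cV_n) = 0 -> u *m P = u.
  move=> u0; have: u \in sum0_space n.
    apply/sum0_spaceP; move/matrixP/(_ 0 0): u0; rewrite !mxE => u0; rewrite -[RHS]u0.
    by apply: eq_bigr => k _; rewrite mxE mulr1.
  rewrite -(span_basis (proj1 v_basis)) => /coord_span->.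
  rewrite mulmx_suml; apply: eq_bigr => i _.
  rewrite -scalemxAl -tnth_nth mulmx_sumr (bigD1 i) //= big1 => [|j ji].
    by rewrite addr0 tensE mulmxA tt eqxx mul1mx.
  by rewrite tensE mulmxA tt eq_sym (negPf ji) mul_scalar_mx scale0r.
have MP p (M : 'M_(p, n)) : M *m (const_mx 1 : 'cV_n) = 0 -> M *m P = M.
  by move=> M0; apply/row_matrixP=> i; rewrite row_mul uP // -row_mul M0 row0.
have PT : P^T = P.
  rewrite linear_sum; apply: eq_bigr => i _.
  by rewrite /= tensE trmx_mul trmxK.
have PX : P *m X = X.
  apply: trmx_inj; rewrite trmx_mul PT MP //.
  by rewrite -[const_mx 1]trmxK -trmx_mul trmx_const Xc trmx0.
rewrite -{1}[X]MP // -{1}PX -mulmxA mulmx_suml.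
apply: eq_bigr => i _; rewrite !mulmx_sumr; apply: eq_bigr => j _.
rewrite !tensE -!mulmxA (mulmxA X) (mulmxA (t i)) mulmxA.
have -> : t i *m (X *m (t j)^T) = (coef i j X)%:M.
  by rewrite mulmxA [LHS]mx11_scalar.
by rewrite mul_mx_scalar -scalemxAl.
Qed.

Lemma lspaceE : lspace = zero_sums_space.
Proof.
apply/eqP; rewrite eqEsubv; apply/andP; split.
  rewrite subv_add; apply/andP; split.
    by apply/span_subvP=> _ /imageP[[i j] /= ij ->]; apply: tens_zero.
  apply/subvP=> _ /HspaceP[g g0 ->]; apply/zero_sums_spaceP; split.
  - rewrite linear_sum -[RHS]g0; apply: eq_bigr => l _.
    by rewrite linearZ /= trE eqxx mulr1.
  - rewrite mulmx_suml big1 // => l _.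
    by rewrite -scalemxAl tensE -mulmxA t1 mulmx0 scaler0.
  - rewrite mulmx_sumr big1 // => l _.
    rewrite -scalemxAr tensE mulmxA -[X in X *m _]trmxK trmx_mul trmxK.
    by rewrite trmx_const t1 trmx0 mul0mx scaler0.
apply/subvP=> X XT; rewrite (resolution XT).
under eq_bigr => i _ do rewrite (bigD1 i) //= addrC.
rewrite big_split /=; apply: memv_add.
  apply: memv_suml => i _; apply: memv_suml => j ji; apply/memvZ/memv_span.
  by apply/imageP; exists (i, j); rewrite //= inE eq_sym.
apply/HspaceP; exists (\row_l coef l l X); last first.
  by apply: eq_bigr => l _; rewrite mxE.
have /zero_sums_spaceP[trX _ _] := XT.
rewrite -[RHS]trX [in RHS](resolution XT) linear_sum.
apply: eq_bigr => i _; rewrite mxE linear_sum (bigD1 i) //= big1 => [|j ji].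
  by rewrite linearZ /= trE eqxx mulr1 addr0.
by rewrite linearZ /= trE eq_sym (negPf ji) mulr0.
Qed.

Lemma lspace_direct : directv (Aspace + Hspace).
Proof.
apply/directv_addP/eqP; rewrite -subv0; apply/subvP=> X.
rewrite memv_cap memv0 => /andP[XA XH].
have XT : X \in zero_sums_space.
  by rewrite -lspaceE (subvP (addvSl _ _)).
have cA i : coef i i X = 0.
  have /subvP/(_ X XA) : (Aspace <= lker (linfun (tens_coef i i)))%VS.
    apply/span_subvP=> _ /imageP[[k l] /= kl ->]; rewrite memv_ker lfunE /=.
    rewrite [tens_coef _ _ _]coefE.
    have [->|//] := eqVneq i k; move: kl; rewrite inE /= eq_sym.
    by move/negPf->.
  by rewrite memv_ker lfunE => /eqP.
have cH i j : i != j -> coef i j X = 0.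
  move=> ij; have /HspaceP[g _ ->] := XH.
  rewrite /coef linear_sum big1 // => l _.
  rewrite linearZ /= [tens_coef _ _ _]coefE.
  by have [<-|_] := eqVneq i l; rewrite ?(negPf ij) scaler0.
rewrite (resolution XT) big1 // => i _; rewrite big1 // => j _.
have [<-|/cH->] := eqVneq i j; last by rewrite scale0r.
by rewrite cA scale0r.
Qed.

Lemma lspace_closed : mxcomm_closed lspace.
Proof. by rewrite lspaceE; apply: zero_sums_closed. Qed.

(* The Lie algebra carried by lspace, with the commutator as bracket. *)
Definition lalg : lieAlgType R := mxlie lspace_closed.

End Spaces.

(* Main.v *)
(* If [e] is the orthogonal projection onto the hyperplane, the double bracket
   [Z |-> [X, [Y, e Z e]]] takes all n x n matrices into the algebra and restricts to
   [ad X ad Y], so it has the same trace; expanding it into maps [Z |-> A Z B], whose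
   traces are [tr A tr B], gives the Killing form [2 (n - 1) tr (X Y)]. The algebra is
   stable under transposition and [tr (X X^T)] is the sum of the squared entries of
   [X], whence nondegeneracy. An abelian ideal is always in the kernel of the Killing
   form, hence zero, and the derived series yields semisimplicity. *)
From HB Require Import structures.
Require Import Defs.
From mathcomp Require Import all_boot all_order all_algebra reals.

Set Implicit Arguments.
Unset Strict Implicit.
Unset Printing Implicit Defensive.

Import GRing.Theory Num.Theory passmx.

Local Open Scope ring_scope.

(** * Traces of endomorphisms of vector and matrix spaces *)

Section LinearTrace.
Variable K : fieldType.

Lemma lftrace_is_linear (V : vectType K) : scalar (@lftrace K V).
Proof. by move=> a f g; rewrite /lftrace linearP /= linearP. Qed.

HB.instance Definition _ (V : vectType K) :=
  GRing.isSemilinear.Build K 'End(V) K _ (@lftrace K V)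
    (GRing.semilinear_linear (@lftrace_is_linear V)).

(** The two spaces may differ, so a trace can be moved from a space to a subspace through which the
    map factors. *)
Lemma lftrace_compC (V W : vectType K) (f : 'Hom(V, W)) (g : 'Hom(W, V)) :
  lftrace (g \o f)%VF = lftrace (f \o g)%VF.
Proof.
rewrite /lftrace (mxof_comp _ _ (vbasisP fullv)).
by rewrite (mxof_comp _ _ (vbasisP fullv)) mxtrace_mulC.
Qed.

Lemma lftrace_id (V : vectType K) : lftrace (\1%VF : 'End(V)) = (\dim {:V})%:R.
Proof. by rewrite /lftrace mxof1 ?mxtrace1 // (basis_free (vbasisP _)). Qed.

Definition scale_vec (V : vectType K) (w : V) (c : K^o) : V := (c : K) *: w.

Fact scale_vec_linear (V : vectType K) (w : V) : linear (scale_vec w).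
Proof. by move=> a c d; rewrite /scale_vec scalerDl scalerA. Qed.

HB.instance Definition _ (V : vectType K) (w : V) :=
  GRing.isSemilinear.Build K K^o V _ (scale_vec w)
    (GRing.semilinear_linear (scale_vec_linear w)).

(** By cyclicity this is a trace on the line [K^o], where the swapped composite is multiplication by
    [phi w]. *)
Lemma lftrace_rank1 (V : vectType K) (phi : 'Hom(V, K^o)) (w : V) :
  lftrace (linfun (scale_vec w) \o phi)%VF = phi w.
Proof.
rewrite lftrace_compC.
have -> : (phi \o linfun (scale_vec w))%VF = phi w *: \1%VF.
  by apply/lfunP=> c; rewrite comp_lfunE !lfunE /= lfunE linearZ; apply: mulrC.
by rewrite linearZ /= lftrace_id dimvf mulr1.
Qed.

Definition mx_entry m n i j (Z : 'M[K]_(m, n)) : K^o := Z i j.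

Fact mx_entry_linear m n i j : linear (@mx_entry m n i j).
Proof. by move=> a Y Z; rewrite /mx_entry !mxE. Qed.

HB.instance Definition _ m n i j :=
  GRing.isSemilinear.Build K 'M[K]_(m, n) K^o _ (@mx_entry m n i j)
    (GRing.semilinear_linear (@mx_entry_linear m n i j)).

Lemma lftrace_mx m n (f : 'End('M[K]_(m, n))) :
  lftrace f = \sum_i \sum_j f (delta_mx i j) i j.
Proof.
(* Decompose [f] into rank-one maps, one for each matrix unit. *)
have {1}-> : f = \sum_i \sum_j
    (linfun (scale_vec (f (delta_mx i j))) \o linfun (mx_entry i j))%VF.
  apply/lfunP=> Z; rewrite {1}[Z]matrix_sum_delta sum_lfunE linear_sum.
  apply: eq_bigr => i _; rewrite sum_lfunE linear_sum; apply: eq_bigr => j _.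
  by rewrite comp_lfunE !lfunE /= linearZ.
rewrite linear_sum; apply: eq_bigr => i _.
rewrite linear_sum; apply: eq_bigr => j _.
by rewrite /= lftrace_rank1 lfunE.
Qed.

Definition mx_sandwich n (A B : 'M[K]_n) : 'End('M[K]_n) :=
  linfun (mulmxr B \o mulmx A).

Lemma mx_sandwichE n (A B Z : 'M[K]_n) : mx_sandwich A B Z = A *m Z *m B.
Proof. by rewrite lfunE. Qed.

Lemma lftrace_mx_sandwich n (A B : 'M[K]_n) :
  lftrace (mx_sandwich A B) = \tr A * \tr B.
Proof.
rewrite lftrace_mx mulr_suml; apply: eq_bigr => i _.
rewrite mulr_sumr; apply: eq_bigr => j _.
(* Splitting the matrix unit as a column times a row exhibits the entry as [A i i * B j j]. *)
rewrite mx_sandwichE -(mul_delta_mx (0 : 'I_1)) mulmxA -colE -mulmxA -rowE.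
by rewrite !mxE big_ord1 !mxE.
Qed.

End LinearTrace.

(** * From a nondegenerate Killing form to semisimplicity *)

Section AbelianIdeals.
Variables (K : fieldType) (L : lieAlgType K).

Lemma lieC (x y : L) : lie x y = - lie y x.
Proof.
apply/eqP; rewrite -addr_eq0; have := liexx (x + y).
rewrite -{1}[x]scale1r lie_linearlE scale1r !linearD /= !liexx add0r addr0.
by move->.
Qed.

(* [ad x ad y] factors through the ideal, on which it vanishes. *)
Lemma killing_abelian_ideal (I : {vspace L}) : lie_ideal I ->
  {in I &, forall x y, lie x y = 0} -> {in I, forall x y, killing x y = 0}.
Proof.
move=> idI abI x Ix y.
pose i : 'Hom(subvs_of I, L) := linfun vsval.
pose p : 'Hom(L, subvs_of I) := linfun (vsproj I).
(* As [x] lies in the ideal, [ad x] takes values there and the projection [p] changes nothing. *)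
have f_ip : (ad x \o ad y = i \o (p \o (ad x \o ad y)))%VF.
  apply/lfunP=> z; rewrite !comp_lfunE !lfunE /= vsprojK //.
  by rewrite lieC rpredN idI.
rewrite /killing f_ip lftrace_compC.
suff -> : ((p \o (ad x \o ad y)) \o i = 0)%VF by rewrite linear0.
apply/lfunP=> z; rewrite !comp_lfunE !lfunE /=.
by rewrite abI ?linear0 ?idI ?subvsP.
Qed.

(** By the Jacobi identity [ad x] is a derivation, so it preserves [[I, I]] whenever it preserves
    [I]. *)
Lemma liebrv_ideal (I : {vspace L}) : lie_ideal I -> lie_ideal (liebrv I I).
Proof.
move=> idI x y Dy; pose adx := linfun (lie x).
have brI a b : a \in I -> b \in I -> lie a b \in liebrv I I.
  by move: a b; apply/liebrvP; exact: subvv.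
suff /subvP/(_ y Dy) : (liebrv I I <= adx @^-1: liebrv I I)%VS.
  by rewrite -memv_preim lfunE.
apply/liebrvP=> a b Ia Ib; rewrite -memv_preim lfunE /=.
have -> : lie x (lie a b) = lie (lie x a) b + lie a (lie x b).
  apply/eqP; rewrite -subr_eq0 opprD addrCA addrC -(lie_jacobi x a b).
  by rewrite (lieC b x) (lieC b (lie x a)) linearN.
by rewrite rpredD // brI // idI.
Qed.

Lemma nondegenerate_semisimple : nondegenerate (@killing K L) -> semisimple L.
Proof.
move=> /eqP nd I idI [k]; elim: k I idI => [//|k IHk] I idI.
(* The derived series of [[I, I]] is one step shorter, so [[I, I]] is zero by induction and [I] is
   abelian. *)
rewrite iterSr => /(IHk _ (liebrv_ideal idI)) DI0.
have abI : {in I &, forall x y, lie x y = 0}.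
  move=> x y Ix Iy; apply/eqP; rewrite -memv0 -DI0.
  by move: x y Ix Iy; apply/liebrvP; exact: subvv.
apply/eqP; rewrite -subv0 -nd; apply/subvP=> x Ix.
by apply/mem_orthovP=> y _; apply: killing_abelian_ideal abI _ _ _.
Qed.

End AbelianIdeals.

Lemma trmx_zero_sums (R : realType) n (X : 'M[R]_n) :
  X \in zero_sums_space R n -> X^T \in zero_sums_space R n.
Proof.
move=> /zero_sums_spaceP[trX Xr Xc].
apply/zero_sums_spaceP; split; first by rewrite mxtrace_tr.
  by apply: trmx_inj; rewrite trmx_mul trmxK trmx_const trmx0.
by apply: trmx_inj; rewrite trmx_mul trmxK trmx_const trmx0.
Qed.

(** * The Killing form of the algebra of zero-sum matrices *)

Section KillingForm.
Variables (R : realType) (n : nat) (v : (n.-1).-tuple 'rV[R]_n).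
Hypotheses (hn : (2 <= n)%N) (hv : orthonormal_basis (sum0_space R n) v).

Let n_neq0 : n%:R != 0 :> R.
Proof. by rewrite pnatr_eq0 -lt0n ltnW. Qed.

Let J : 'M[R]_n := const_mx 1.
(** [J] divided by [n] projects onto the line of constant vectors; [e] is the complementary
    projection. *)
Let e : 'M[R]_n := 1%:M - n%:R^-1 *: J.

Lemma lalg_zero_sums (x : lalg hv) : vsval x \in zero_sums_space R n.
Proof. by rewrite -(lspaceE hv) subvsP. Qed.

Lemma val_lie (x y : lalg hv) : vsval (lie x y) = mxcomm (vsval x) (vsval y).
Proof. by []. Qed.

Let mxtrace_e : \tr e = n.-1%:R.
Proof.
rewrite linearB linearZ /= mxtrace1.
have -> : \tr J = n%:R.
  rewrite /mxtrace (eq_bigr (fun=> 1)) => [|i _]; last by rewrite mxE.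
  by rewrite sumr_const card_ord.
by rewrite mulVf // -subn1 natrB // ltnW.
Qed.

Let e1 : e *m (const_mx 1 : 'cV_n) = 0.
Proof.
apply/matrixP=> i j; rewrite mulmxBl mul1mx -scalemxAl !mxE.
rewrite (eq_bigr (fun=> 1)) => [|k _]; last by rewrite !mxE mulr1.
by rewrite sumr_const card_ord mulVf // subrr.
Qed.

Let eT : e^T = e.
Proof. by rewrite linearB linearZ /= trmx1 trmx_const. Qed.

Let e1' : (const_mx 1 : 'rV_n) *m e = 0.
Proof. by apply: trmx_inj; rewrite trmx_mul eT trmx_const e1 trmx0. Qed.

Let mul_e m (X : 'M_(m, n)) : X *m (const_mx 1 : 'cV_n) = 0 -> X *m e = X.
Proof.
move=> X1; have XJ : X *m J = 0.
  apply/matrixP=> i j; move/matrixP/(_ i 0): X1; rewrite !mxE => X1.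
  by rewrite -[RHS]X1; apply: eq_bigr => k _; rewrite !mxE.
by rewrite mulmxBr mulmx1 -scalemxAr XJ scaler0 subr0.
Qed.

Let e_mul (X : 'M_n) : (const_mx 1 : 'rV_n) *m X = 0 -> e *m X = X.
Proof.
move=> X1; apply: trmx_inj; rewrite trmx_mul eT mul_e //.
by apply: trmx_inj; rewrite trmx_mul trmxK trmx_const trmx0.
Qed.

Lemma killingE (x y : lalg hv) :
  killing x y = \tr (vsval x *m vsval y) *+ (n.-1).*2.
Proof.
have /zero_sums_spaceP[trX Xr Xc] := lalg_zero_sums x.
have /zero_sums_spaceP[trY Yr Yc] := lalg_zero_sums y.
set X := vsval x in trX Xr Xc *; set Y := vsval y in trY Yr Yc *.
(* The expansion of [[X, [Y, e Z e]]], with [e] absorbed wherever it meets [X] or [Y]. *)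
pose g := mx_sandwich (X *m Y) e - mx_sandwich X Y
          - (mx_sandwich Y X - mx_sandwich e (Y *m X)).
pose i : 'Hom(lalg hv, 'M[R]_n) := linfun vsval.
pose p : 'Hom('M[R]_n, lalg hv) := linfun (vsproj (lspace v)).
have gE Z : g Z = X *m Y *m Z *m e - X *m Z *m Y
                  - (Y *m Z *m X - e *m Z *m (Y *m X)).
  by rewrite !(add_lfunE, opp_lfunE) !mx_sandwichE.
have g_zero Z : g Z \in lspace v.
  rewrite (lspaceE hv) gE; apply/zero_sums_spaceP; split.
  - rewrite !(raddfB mxtrace) /=.
    have -> : \tr (X *m Y *m Z *m e) = \tr (X *m Y *m Z).
      by rewrite mxtrace_mulC !mulmxA e_mul.
    have -> : \tr (X *m Z *m Y) = \tr (Y *m X *m Z).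
      by rewrite mxtrace_mulC !mulmxA.
    have -> : \tr (Y *m Z *m X) = \tr (X *m Y *m Z).
      by rewrite mxtrace_mulC !mulmxA.
    have -> : \tr (e *m Z *m (Y *m X)) = \tr (Y *m X *m Z).
      by rewrite mxtrace_mulC !mulmxA -(mulmxA Y X e) mul_e.
    exact: subrr.
  - by rewrite !mulmxBl -!mulmxA e1 Xr Yr !mulmx0 !subrr.
  - by rewrite !mulmxBr !mulmxA e1' Xc Yc !mul0mx !subrr.
have iE z : i z = vsval z by rewrite lfunE.
have pE Z : p Z = vsproj (lspace v) Z by rewrite lfunE.
have adE : (ad x \o ad y = (p \o g) \o i)%VF.
  apply/lfunP=> z; apply: val_inj.
  have /zero_sums_spaceP[_ Zr Zc] := lalg_zero_sums z.
  rewrite !comp_lfunE iE pE /= vsprojK // gE !lfunE !val_lie.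
  by rewrite /mxcomm e_mul // -mulmxA mul_e // mulmxBl mulmxBr !mulmxA.
(* The range of [g] lies in the algebra, so cyclicity turns the trace of [ad x \o ad y] into that of
   [g] on all matrices. *)
have ipg : (i \o (p \o g) = g)%VF.
  by apply/lfunP=> Z; rewrite !comp_lfunE iE pE vsprojK.
rewrite /killing adE lftrace_compC ipg !linearB /= !lftrace_mx_sandwich.
(* The middle terms vanish since [X] and [Y] are traceless; each outer one gives [n.-1] times the
   trace of [X *m Y]. *)
rewrite trX trY !mul0r mxtrace_e [\tr (Y *m X)]mxtrace_mulC subr0 sub0r opprK.
by rewrite mulr_natr mulr_natl -mulrnDr addnn.
Qed.

Lemma killing_nondegenerate : nondegenerate (@killing R (lalg hv)).
Proof.
rewrite /nondegenerate -subv0; apply/subvP=> x /mem_orthovP xK.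
have xTl : (vsval x)^T \in lspace v.
  by have := trmx_zero_sums (lalg_zero_sums x); rewrite -(lspaceE hv).
(* Pairing [x] with its transpose gives a positive multiple of a sum of squares. *)
have /eqP : killing x (Subvs xTl : lalg hv) = 0 by apply: xK; apply: memvf.
have n1 : (n.-1 == 0)%N = false by case: n hn => [|[]].
rewrite killingE /= mulrn_eq0 double_eq0 n1 /=.
(* A vanishing sum of nonnegative terms has zero terms: first the diagonal entries of the product,
   then the squared entries in each row. *)
rewrite /mxtrace psumr_eq0 => [/allP x0|i _]; last first.
  by rewrite mxE sumr_ge0 // => j _; rewrite !mxE -expr2 sqr_ge0.
rewrite memv0; apply/eqP/val_inj/matrixP=> i j /=; rewrite [RHS]mxE.
have := x0 i (mem_index_enum i); rewrite /= mxE psumr_eq0 => [/allP xi|k _].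
  by have := xi j (mem_index_enum j); rewrite /= mxE mulf_eq0 orbb => /eqP.
by rewrite mxE -expr2 sqr_ge0.
Qed.

End KillingForm.

Theorem corollary3p2 (R : realType) (n : nat) (hn : (2 <= n)%N)
    (v : (n.-1).-tuple 'rV[R]_n)
    (hv : orthonormal_basis (sum0_space R n) v) :
  nondegenerate (@killing R (lalg hv)) /\ semisimple (lalg hv).
Proof.
have nd := killing_nondegenerate hn hv.
by split=> //; apply: nondegenerate_semisimple.
Qed.
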